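(* Under Assumption A, the limit curve of the sandpile $$\mathcal C=\left\{\frac{u}{\Gamma^{-1}(u)\cdot u}: u\in\mathbb S^{d-1}\right\}$$ is the boundary of a convex subset of $\mathbb R^d$.
   Context: Setting. $d,p\ge1$ are integers. For $x\in\mathbb Z^d$, $i,j\in\{1,\dots,p\}$ let $c(x,i,j)\ge 0$, with $0<\sigma_i:=\sum_{(y,j)}c(y,i,j)<\infty$, and let $m_i\ge1$ be leakiness parameters. Put $\mu_{i,j}(x)=\frac{c(x,i,j)}{m_i\sigma_i}$. The killed random walk (KRW) $(X_n)$ on $(\mathbb Z^d\times\{1,\dots,p\})\sqcup\{\mathsf k\}$ jumps from $(x,i)$ to $(y,j)$ with probability $\mu_{i,j}(y-x)$ and from $(x,i)$ to the absorbing cemetery $\mathsf k$ with probability $1-\frac1{m_i}$. Assumption A: (1) $m_i>1$ for at least one $i$; (2) the KRW is irreducible: every $(x,j)$ can be reached from every $(0,i)$ with positive probability in some number $n\ge1$ of steps; (3) it is aperiodic: $\gcd\{n\ge1:\mathbb P_{(x,i)}(X_n=(x,i))>0\}=1$ for all $(x,i)$; (4) $\sum_{x}e^{\gamma\|x\|}\mu_{i,j}(x)<\infty$ for all $i,j$ and all $\gamma>0$. For $t\in\mathbb R^d$ let $L\mu(t)$ be the $p\times p$ matrix with entries $\sum_{x\in\mathbb Z^d}e^{t\cdot x}\mu_{i,j}(x)$ and $\rho(t)$ its spectral radius; $\partial\mathcal T=\{t:\rho(t)=1\}$. The map $\Gamma:\partial\mathcal T\to\mathbb S^{d-1}$, $\Gamma(t)=\nabla\rho(t)/\|\nabla\rho(t)\|$,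 is a homeomorphism (known result), and $\Gamma^{-1}(u)\cdot u>0$ for all $u$. *)

(* Defs.v *)
From HB Require Import structures.
From mathcomp Require Import all_boot all_order all_algebra.
From mathcomp Require Import all_classical all_reals all_analysis.
From mathcomp Require Import complex.
Set Implicit Arguments.
Unset Strict Implicit.
Unset Printing Implicit Defensive.
Import Order.TTheory GRing.Theory Num.Theory.
Import numFieldNormedType.Exports.
Local Open Scope classical_set_scope.
Local Open Scope ring_scope.

Definition dotv (R : realType) (d : nat) (u v : 'rV[R]_d) : R :=
  \sum_(k < d) u 0 k * v 0 k.

(* The Euclidean norm; the library norm `|u| on 'rV[R]_d is the sup norm
   (both induce the same topology). *)
Definition enorm (R : realType) (d : nat) (u : 'rV[R]_d) : R :=
  Num.sqrt (dotv u u).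

Definition usphere (R : realType) (d : nat) : set 'rV[R]_d :=
  [set u | enorm u = 1].

Definition zvec (R : realType) (d : nat) (x : 'rV[int]_d) : 'rV[R]_d :=
  map_mx (fun z : int => z%:~R) x.
Arguments zvec R {d} x.

Definition grad (R : realType) (d : nat) (f : 'rV[R]_d -> R) (t : 'rV[R]_d) :
    'rV[R]_d :=
  \row_(k < d) 'D_(delta_mx 0 k) f t.

Definition boundary (T : topologicalType) (A : set T) : set T :=
  closure A `\` interior A.

(* Largest modulus of a complex eigenvalue. The eigenvalues in R[i] form a
   finite set, nonempty as soon as p > 0, so that sup is then a maximum. *)
Definition spectral_radius (R : realType) (p : nat) (A : 'M[R]_p) : R :=
  sup [set Normc.normc l |
        l in [set l : R[i] | eigenvalue (map_mx (real_complex R) A) l]].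

(* g is the gcd of the (possibly infinite) set S of natural numbers. *)
Definition is_gcd_of (S : set nat) (g : nat) : Prop :=
  (forall n, S n -> (g %| n)%N) /\
  (forall k, (forall n, S n -> (k %| n)%N) -> (k %| g)%N).

Section KilledRandomWalk.
Variables (R : realType) (d p : nat).
(* c x i j is the weight of a jump by x from type i to type j. *)
Variables (c : 'rV[int]_d -> 'I_p -> 'I_p -> R) (m : 'I_p -> R).

Definition sigma (i : 'I_p) : \bar R :=
  (\esum_(z in [set: 'rV[int]_d * 'I_p]) (c z.1 i z.2)%:E)%E.

Definition mu (i j : 'I_p) (x : 'rV[int]_d) : R :=
  c x i j / (m i * fine (sigma i)).

(* None is the cemetery. *)
Local Notation krw_state := (option ('rV[int]_d * 'I_p)).

Definition krw_step (s s' : krw_state) : R :=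
  match s, s' with
  | Some (x, i), Some (y, j) => mu i j (y - x)
  | Some (x, i), None => 1 - (m i)^-1
  | None, Some _ => 0
  | None, None => 1
  end.

(* The probability that X_n = s' when X_0 = s (Chapman-Kolmogorov). *)
Fixpoint krw_prob (n : nat) (s s' : krw_state) : \bar R :=
  match n with
  | 0%N => ((s == s')%:R)%:E
  | n'.+1 => (\esum_(z in [set: krw_state])
                (krw_step s z)%:E * krw_prob n' z s')%E
  end.

Definition krw_irreducible : Prop :=
  forall (i j : 'I_p) (x : 'rV[int]_d),
    exists2 n : nat, (1 <= n)%N & (0 < krw_prob n (Some (0%R, i)) (Some (x, j)))%E.

Definition krw_aperiodic : Prop :=
  forall (x : 'rV[int]_d) (i : 'I_p),
    is_gcd_of
      [set n | (1 <= n)%N /\ (0 < krw_prob n (Some (x, i)) (Some (x, i)))%E]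
      1%N.

Definition exp_moments : Prop :=
  forall (i j : 'I_p) (gamma : R), 0 < gamma ->
    (\esum_(x in [set: 'rV[int]_d])
       (expR (gamma * enorm (zvec R x)) * mu i j x)%:E < +oo)%E.

Definition assumptionA : Prop :=
  [/\ exists i, 1 < m i, krw_irreducible, krw_aperiodic & exp_moments].

(* The sum is finite under exp_moments. *)
Definition Lmu (t : 'rV[R]_d) : 'M[R]_p :=
  \matrix_(i < p, j < p)
    fine (\esum_(x in [set: 'rV[int]_d])
            (expR (dotv t (zvec R x)) * mu i j x)%:E).

Definition rho (t : 'rV[R]_d) : R := spectral_radius (Lmu t).

Definition dT : set 'rV[R]_d := [set t | rho t = 1].

Definition Gam (t : 'rV[R]_d) : 'rV[R]_d :=
  (enorm (grad rho t))^-1 *: grad rho t.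

(* Under assumptionA, Gam maps dT bijectively onto the unit sphere; outside
   the image of dT, pinv
   takes an arbitrary default value. *)
Definition Gam_inv : 'rV[R]_d -> 'rV[R]_d := pinv dT Gam.

Definition limit_curve : set 'rV[R]_d :=
  [set (dotv (Gam_inv u) u)^-1 *: u | u in @usphere R d].

End KilledRandomWalk.

(* Main.v *)
Require Import Defs.
From HB Require Import structures.
From mathcomp Require Import all_boot all_order all_algebra.
From mathcomp Require Import all_classical all_reals all_analysis.
From mathcomp Require Import complex ring lra.
Set Implicit Arguments.
Unset Strict Implicit.
Unset Printing Implicit Defensive.
Import Order.TTheory GRing.Theory Num.Theory.
Import numFieldNormedType.Exports.
Local Open Scope classical_set_scope.
Local Open Scope ring_scope.

(** The limit curve is the boundary of the polar of T = {t | rho t <= 1}.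

    Perron-Frobenius theory gives rho t as the least r such that L(t) w <= r w
    for some positive w. With w = exp phi, the coefficients of L(t) w / w are
    jointly convex in (t, phi), so rho is convex. Perturbing a Perron
    eigenvector w into w + e y, where y solves the linearised eigenvalue
    equation, bounds rho (t + e h) by rho t + a e + O(e^2) for both signs of e;
    together with convexity this makes rho differentiable in every direction,
    with a linear derivative.

    The maximiser of u.t over the compact set T is then a point of dT whose
    outer normal is u, so that Gam is onto the sphere. Conversely any t in dT
    with Gam t = u satisfies t.u = max_(s in T) s.u, by the subgradient
    inequality. Hence Gam_inv u . u is the support function of T, which is
    positive as rho 0 < 1, and the vectors u / (Gam_inv u . u) are exactly the
    boundary points of the polar of T, because T is bounded. *)

(** * Perron-Frobenius theory *)

Definition nonneg_mx (R : realType) (m n : nat) (A : 'M[R]_(m, n)) : Prop :=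
  forall i j, 0 <= A i j.

Definition pos_mx (R : realType) (m n : nat) (A : 'M[R]_(m, n)) : Prop :=
  forall i j, 0 < A i j.

(** Since [k = 0] is allowed, the zero matrix of size one counts as irreducible; its Perron value is
    [0]. *)
Definition irreducible_mx (R : realType) (n : nat) (A : 'M[R]_n) : Prop :=
  nonneg_mx A /\ forall i j, exists k, 0 < (A ^+ k) i j.

Section Perron.
Variable R : realType.

Lemma nonneg_mulmx m n k (A : 'M[R]_(m, n)) (B : 'M[R]_(n, k)) :
  nonneg_mx A -> nonneg_mx B -> nonneg_mx (A *m B).
Proof.
move=> A0 B0 i j; rewrite mxE; apply: sumr_ge0 => l _.
by rewrite mulr_ge0 ?A0 ?B0.
Qed.

Lemma nonneg_expmx n (A : 'M[R]_n) k : nonneg_mx A -> nonneg_mx (A ^+ k).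
Proof.
move=> A0; elim: k => [|k IH]; first by move=> i j; rewrite expr0 mxE ler0n.
by rewrite exprS -mulmxE; exact: nonneg_mulmx.
Qed.

Lemma pos_mulmx_row (n : nat) (B : 'M[R]_n) (z : 'rV[R]_n) :
  pos_mx B -> nonneg_mx z -> z != 0 -> pos_mx (z *m B).
Proof.
move=> B0 z0 zn0 i j; rewrite mxE.
have /rV0Pn[k zk] := zn0.
rewrite (bigD1 k)//= ltr_pwDl//; last first.
  by apply: sumr_ge0 => l _; rewrite mulr_ge0 ?z0 ?ltW ?B0.
rewrite (ord1 i) mulr_gt0 ?B0// lt_neqAle eq_sym zk; exact: z0.
Qed.

Lemma irreducible_tr n (A : 'M[R]_n) : irreducible_mx A -> irreducible_mx A^T.
Proof.
move=> [A0 Ai]; split=> [i j|i j]; first by rewrite mxE.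
have trX k : A^T ^+ k = (A ^+ k)^T.
  elim: k => [|k IH]; first by rewrite !expr0 trmx1.
  by rewrite exprSr IH exprS -!mulmxE trmx_mul.
by have [k kP] := Ai j i; exists k; rewrite trX mxE.
Qed.

(* A sum of powers of A suffices: only commutation with A, positivity and the
   action on eigenvectors are used. *)
Lemma irreducible_pos_comm n (A : 'M[R]_n) : irreducible_mx A ->
  exists B : 'M[R]_n, [/\ pos_mx B, A *m B = B *m A &
    forall (r : R), exists b, (0 <= r -> 0 <= b) /\
     forall x : 'rV[R]_n, x *m A = r *: x -> x *m B = b *: x].
Proof.
move=> [A0 /(_ _) Ai].
have /choice[K KP] : forall ij, exists k, 0 < (A ^+ k) ij.1 ij.2.
  by move=> ij; exact: Ai.
exists (\sum_(ij : 'I_n * 'I_n) A ^+ K ij); split.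
- move=> i j; rewrite summxE (bigD1 (i, j))//= ltr_pwDl ?(KP (i, j))//.
  by apply: sumr_ge0 => l _; exact: nonneg_expmx.
- rewrite mulmx_sumr mulmx_suml; apply: eq_bigr => ij _.
  by rewrite mulmxE -exprS -exprSr.
- move=> r; exists (\sum_ij r ^+ K ij); split.
    by move=> r0; apply: sumr_ge0 => *; exact: exprn_ge0.
  move=> x xA; rewrite mulmx_sumr scaler_suml; apply: eq_bigr => ij _.
  elim: (K ij) => [|k IH]; first by rewrite !expr0 mulmx1 scale1r.
  by rewrite exprSr -mulmxE mulmxA IH -scalemxAl xA scalerA exprSr.
Qed.

Lemma dominate_pos n (x y : 'I_n -> R) : (forall i, 0 < y i) ->
  exists2 C, 0 < C & forall i, `|x i| <= C * y i.
Proof.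
move=> y0; exists (1 + \sum_i `|x i| / y i).
  by rewrite ltr_pwDl// sumr_ge0// => i _; rewrite divr_ge0// ltW.
move=> i; rewrite -ler_pdivrMr// (bigD1 i)//= ler_wpDl// lerDl.
by rewrite sumr_ge0// => j _; rewrite divr_ge0// ltW.
Qed.

(** Subtract from [y] the largest multiple of [v] that leaves a nonnegative rest [z]. The rest
    vanishes at some coordinate [k]; were it nonzero, [z *m B = b *: z] would be positive there. *)
Lemma perron_unique n (A : 'M[R]_n) (r : R) (v y : 'rV[R]_n) :
  irreducible_mx A -> pos_mx v -> v *m A = r *: v -> y *m A = r *: y ->
  exists k, y = k *: v.
Proof.
move=> Ai v0 vA yA.
have [->|/rV0Pn[i0 _]] := eqVneq y 0; first by exists 0; rewrite scale0r.
case: (Order.TotalTheory.arg_minP (fun i => y 0 i / v 0 i) (erefl : predT i0)) => k _ kP.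
exists (y 0 k / v 0 k); apply/eqP; rewrite -subr_eq0; apply/negPn/negP => zn0.
set z := y - _ in zn0.
have z0 : nonneg_mx z.
  by move=> i j; rewrite (ord1 i) !mxE subr_ge0 -ler_pdivlMr ?v0// kP.
have zA : z *m A = r *: z.
  by rewrite mulmxBl -scalemxAl vA yA scalerBr !scalerA mulrC.
have [B [B0 _ /(_ r)[b [_ /(_ z zA)]]]] := irreducible_pos_comm Ai.
have /(_ 0 k) := pos_mulmx_row B0 z0 zn0.
by move=> /[swap] ->; rewrite !mxE divfK ?gt_eqF ?v0// subrr mulr0 ltxx.
Qed.

Lemma pos_dot n (v : 'rV[R]_n.+1) (w : 'cV[R]_n.+1) :
  pos_mx v -> pos_mx w -> 0 < (v *m w) 0 0.
Proof.
move=> v0 w0; rewrite mxE (bigD1 0)//= ltr_pwDl ?mulr_gt0//.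
by apply: sumr_ge0 => i _; rewrite mulr_ge0// ltW.
Qed.

Lemma continuous_sum (T : topologicalType) (I : Type) (r : seq I) (F : I -> T -> R) :
  (forall i, continuous (F i)) -> continuous (fun x => \sum_(i <- r) F i x).
Proof. by move=> cF; apply: continuous_big => //; exact: add_continuous. Qed.

Definition simplex n : set 'rV[R]_n :=
  [set x | nonneg_mx x /\ \sum_i x 0 i = 1].

Lemma simplex_compact n : compact (@simplex n).
Proof.
apply: (subclosed_compact _ (@rV_compact _ n (fun=> `[0 : R, 1]%classic) _)).
- have -> : @simplex n = (\bigcap_(i in [set: 'I_n]) [set x : 'rV[R]_n | 0 <= x 0 i]) `&`
      [set x : 'rV[R]_n | \sum_i x 0 i = 1].
    apply/seteqP; split=> x /=.
      by move=> [x0 x1]; split=> // i _; exact: x0.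
    by move=> [x0 x1]; split=> // i j; rewrite (ord1 i); exact: x0.
  apply: closedI.
    apply: closed_bigI => i _.
    apply: (@closed_comp _ _ (fun x : 'rV[R]_n => x 0 i) [set y | 0 <= y]).
      by move=> x _; exact: coord_continuous.
    exact: closed_ge.
  apply: (@closed_comp _ _ (fun x : 'rV[R]_n => \sum_i x 0 i) [set y | y = 1]).
    move=> x _; apply: continuous_sum => i; exact: coord_continuous.
  exact: closed_eq.
- by move=> i; exact: segment_compact.
- move=> x [x0 x1] i; rewrite /= in_itv/= x0 -x1 (bigD1 i)//= lerDl.
  by apply: sumr_ge0 => j _; exact: x0.
Qed.

(** The Collatz-Wielandt condition, written without division so that zero coordinates are allowed
    and the set is closed. *)
Definition subinvariant n (A : 'M[R]_n) : set ('rV[R]_n * R) :=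
  [set xs : 'rV[R]_n * R | forall i, xs.2 * xs.1 0 i <= (xs.1 *m A) 0 i].

Lemma subinvariant_closed n (A : 'M[R]_n) : closed (subinvariant A).
Proof.
have -> : subinvariant A = \bigcap_(i in [set: 'I_n])
    [set xs : 'rV[R]_n * R | 0 <= (xs.1 *m A) 0 i - xs.2 * xs.1 0 i].
  apply/seteqP; split=> x /= h i; first by move=> _ /=; rewrite subr_ge0.
  by have := h i I; rewrite /= subr_ge0.
apply: closed_bigI => i _.
apply: (@closed_comp _ _ (fun xs : 'rV[R]_n * R => (xs.1 *m A) 0 i - xs.2 * xs.1 0 i)
    [set y | 0 <= y]); last exact: closed_ge.
move=> x _.
have c1 j : continuous (fun xs : 'rV[R]_n * R => xs.1 0 j).
  move=> y; apply: (@continuous_comp _ _ _ fst (fun v : 'rV[R]_n => v 0 j)).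
    exact: cvg_fst.
  exact: coord_continuous.
have c2 : continuous (fun xs : 'rV[R]_n * R => (xs.1 *m A) 0 i).
  rewrite (_ : (fun xs : 'rV[R]_n * R => _) = (fun xs => \sum_j xs.1 0 j * A j i)).
    by apply: continuous_sum => j y; apply: cvgM; [exact: c1|exact: cvg_cst].
  by apply/funext => y; rewrite mxE.
by apply: cvgB; [exact: c2|apply: cvgM; [exact: cvg_snd|exact: c1]].
Qed.

(** Maximise [s] over the pairs with [x] in the simplex and [s x <= x A]. If the maximiser were not
    an eigenvector, multiplying by the positive matrix [B], which commutes with [A], would make the
    inequality strict in every coordinate and leave room for a larger [s]. *)
Lemma perron_exists n (A : 'M[R]_n.+1) : irreducible_mx A ->
  exists r (v : 'rV[R]_n.+1), [/\ 0 <= r, pos_mx v & v *m A = r *: v].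
Proof.
move=> Ai; have A0 := Ai.1.
pose M := \sum_i \sum_j A i j.
have M0 : 0 <= M by apply: sumr_ge0 => i _; apply: sumr_ge0 => j _; exact: A0.
pose Q := (@simplex n.+1 `*` `[0, M]%classic) `&` subinvariant A.
have Qc : compact Q.
  apply: compact_closedI; last exact: subinvariant_closed.
  by apply: compact_setX; [exact: simplex_compact|exact: segment_compact].
have Q0 : Q !=set0.
  exists (delta_mx 0 0, 0); split=> /=; last first.
    move=> i /=; rewrite mul0r; apply: nonneg_mulmx => //.
    by move=> *; rewrite mxE ler0n.
  rewrite in_itv/= lexx M0; split=> //; split; first by move=> *; rewrite mxE ler0n.
  rewrite (bigD1 0)//= big1 ?addr0 ?mxE ?eqxx//.
  by move=> j /negPf j0; rewrite mxE eqxx j0.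
have snd_c : {within Q, continuous (snd : 'rV[R]_n.+1 * R -> R)}.
  by apply: continuous_subspaceT => x; exact: cvg_snd.
have [[x r]] := compact_EVT_max Q0 Qc snd_c.
rewrite inE => -[[/= [x0 x1]]]; rewrite in_itv/= => /andP[r0 _] xr rmax.
(* The cutoff at [M] loses nothing: summing [s y <= y A] over the coordinates gives [s <= M]. *)
have bnd y s : simplex y -> (forall i, s * y 0 i <= (y *m A) 0 i) -> s <= r.
  move=> [y0 y1] sy; rewrite leNgt; apply/negP => rs.
  suff : s <= r by rewrite leNgt rs.
  apply: (rmax (y, s)); rewrite inE; split=> //; split=> //=.
  rewrite in_itv/= (ltW (le_lt_trans r0 rs))/=.
  have -> : s = \sum_i s * y 0 i by rewrite -mulr_sumr y1 mulr1.
  apply: (le_trans (ler_sum _ (fun i _ => sy i))).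
  rewrite (eq_bigr (fun i => \sum_j y 0 j * A j i)); last by move=> i _; rewrite mxE.
  rewrite exchange_big/=; apply: ler_sum => j _; apply: ler_sum => i _.
  rewrite ler_piMl//.
  by rewrite -y1 (bigD1 j)//= lerDl; apply: sumr_ge0 => l _; exact: y0.
have [B [B0 AB /(_ r)[b [/(_ r0) b0 bP]]]] := irreducible_pos_comm Ai.
have xn0 : x != 0.
  by apply/eqP => xE; move/eqP: x1; rewrite xE big1 ?(eq_sym 0) ?oner_eq0// => i _; rewrite mxE.
have xB0 := pos_mulmx_row B0 x0 xn0.
have xA : x *m A = r *: x.
  apply/eqP; rewrite -subr_eq0; apply/negPn/negP => zn0.
  set z := (_ - _) in zn0.
  have z0 : nonneg_mx z by move=> i j; have := xr j; rewrite (ord1 i) /= !mxE subr_ge0.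
  have zB0 := pos_mulmx_row B0 z0 zn0.
  (* [C] turns strictness into a gain: [z B] dominates [x B / C], so the normalised [x B] admits the
     value [r + 1 / C]. *)
  have [C C0 CP] := dominate_pos (fun i => (x *m B) 0 i) (zB0 0).
  pose S := \sum_i (x *m B) 0 i.
  have S0 : 0 < S.
    by rewrite /S (bigD1 0)//= ltr_pwDl// sumr_ge0// => i _; exact: ltW.
  suff : r + C^-1 <= r by rewrite gerDl leNgt invr_gt0 C0.
  apply: (bnd (S^-1 *: (x *m B))).
    split; first by move=> i j; rewrite mxE mulr_ge0 ?invr_ge0 ?ltW.
    under eq_bigr do rewrite mxE.
    by rewrite -mulr_sumr mulVf ?gt_eqF.
  move=> i; rewrite -scalemxAl mxE mulrCA [leRHS]mxE ler_pM2l ?invr_gt0//.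
  have -> : x *m B *m A = z *m B + r *: (x *m B).
    by rewrite mulmxBl -scalemxAl addrNK -!mulmxA AB.
  rewrite [leRHS]mxE [X in _ <= _ + X]mxE [leRHS]addrC mulrDl lerD2l mulrC.
  rewrite ler_pdivrMr//.
  by rewrite mulrC (le_trans (ler_norm _))// CP.
exists r, x; split=> // i j; rewrite (ord1 i) lt_neqAle x0 andbT.
apply/negP => /eqP xj; have := xB0 0 j.
by rewrite (bP x xA) mxE -xj mulr0 ltxx.
Qed.

(** Let [a] be the vector of moduli of a left eigenvector for [l]. The triangle inequality gives
    [|l| a <= a A], and pairing with the positive [w] gives [|l| a w <= r a w]. *)
Lemma eigenvalue_norm_le n (A : 'M[R]_n) (w : 'cV[R]_n) (r : R) (l : R[i]) :
  nonneg_mx A -> pos_mx w -> (forall i, (A *m w) i 0 <= r * w i 0) ->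
  eigenvalue (map_mx (real_complex R) A) l -> Normc.normc l <= r.
Proof.
move=> A0 w0 Aw /eigenvalueP[y yA yn0].
pose a : 'rV[R]_n := \row_j Normc.normc (y 0 j).
have a0 : nonneg_mx a.
  by move=> i j; rewrite mxE; case: (y 0 j) => a1 a2; exact: sqrtr_ge0.
have la j : Normc.normc l * a 0 j <= (a *m A) 0 j.
  have := congr1 (fun z : 'rV_n => Normc.normc (z 0 j)) yA.
  rewrite !mxE Normc.normcM => <-.
  rewrite (@eq_bigr _ _ _ _ _ _ _
    (fun k => Normc.normc (y 0 k * (map_mx (real_complex R) A) k j))); last first.
    move=> k _; rewrite !mxE Normc.normcM/=; congr (_ * _).
    by rewrite expr0n addr0 sqrtr_sqr ger0_norm.
  elim/big_ind2 : _ => [||//]; first by rewrite Normc.normc0.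
  by move=> z1 z2 z3 z4 h1 h2; apply: le_trans (le_normcD _ _) _; exact: lerD.
have aw0 : 0 < \sum_j a 0 j * w j 0.
  have /rV0Pn[k yk] := yn0.
  rewrite (bigD1 k)//= ltr_pwDl//; last first.
    by apply: sumr_ge0 => i _; rewrite mulr_ge0// ltW.
  rewrite mulr_gt0// lt_neqAle a0 andbT eq_sym mxE.
  by apply/eqP => /Normc.eq0_normc/eqP; exact/negP.
rewrite -(ler_pM2r aw0) !mulr_sumr.
under eq_bigr do rewrite mulrA.
apply: (@le_trans _ _ (\sum_j (a *m A) 0 j * w j 0)).
  by apply: ler_sum => j _; rewrite ler_pM2r.
have -> : \sum_j (a *m A) 0 j * w j 0 = (a *m (A *m w)) 0 0.
  by rewrite mulmxA [RHS]mxE.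
rewrite mxE; apply: ler_sum => j _; rewrite mulrCA; apply: ler_wpM2l => //.
Qed.

(** The Perron values of [A] and of its transpose agree because [v A w] can be computed both ways
    and [v w > 0]. The common value is an eigenvalue, and [eigenvalue_norm_le] bounds the modulus of
    every eigenvalue by it. *)
Lemma perron n (A : 'M[R]_n.+1) : irreducible_mx A ->
  exists (v : 'rV[R]_n.+1) (w : 'cV[R]_n.+1),
    [/\ pos_mx v, pos_mx w, v *m A = spectral_radius A *: v &
        A *m w = spectral_radius A *: w].
Proof.
move=> Ai.
have [r [v [r0 v0 vA]]] := perron_exists Ai.
have [s [u [s0 u0 uA]]] := perron_exists (irreducible_tr Ai).
pose w := u^T.
have w0 : pos_mx w by move=> i j; rewrite mxE.
have Aw : A *m w = s *: w.
  by apply: trmx_inj; rewrite trmx_mul trmxK uA linearZ/= trmxK.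
have vw0 := pos_dot v0 w0.
have rs : r = s.
  have : v *m A *m w = v *m (A *m w) by rewrite mulmxA.
  rewrite vA Aw -scalemxAl -scalemxAr => /(congr1 (fun z : 'M[R]_(1, 1) => z 0 0)).
  by rewrite mxE [RHS]mxE; apply: mulIf; rewrite gt_eqF.
suff srE : spectral_radius A = r.
  by exists v, w; rewrite srE; split=> //; rewrite rs.
have rE : [set Normc.normc l | l in
     [set l : R[i] | eigenvalue (map_mx (real_complex R) A) l]] r.
  exists (real_complex R r); last by rewrite /= expr0n addr0 sqrtr_sqr ger0_norm.
  apply/eigenvalueP; exists (map_mx (real_complex R) v).
    by rewrite -map_mxM vA map_mxZ.
  by rewrite map_mx_eq0; apply/rV0Pn; exists 0; rewrite gt_eqF.
apply/eqP; rewrite eq_le; apply/andP; split.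
  apply: ge_sup; first by exists r.
  move=> _ [l le <-]; apply: (eigenvalue_norm_le Ai.1 w0) le => i.
  by rewrite Aw -rs mxE.
apply: ub_le_sup => //; exists r => _ [l le <-].
apply: (eigenvalue_norm_le Ai.1 w0) le => i.
by rewrite Aw -rs mxE.
Qed.

(** Pair with the left Perron vector. Both convexity and perturbation bounds are obtained from this
    by exhibiting a test vector [w]. *)
Lemma spectral_radius_le n (A : 'M[R]_n.+1) (w : 'cV[R]_n.+1) (r : R) :
  irreducible_mx A -> pos_mx w -> (forall i, (A *m w) i 0 <= r * w i 0) ->
  spectral_radius A <= r.
Proof.
move=> Ai w0 Aw; have [v [_ [v0 _ vA _]]] := perron Ai.
have vw0 := pos_dot v0 w0.
rewrite -(ler_pM2r vw0).
have -> : spectral_radius A * (v *m w) 0 0 = (v *m (A *m w)) 0 0.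
  by rewrite mulmxA vA -scalemxAl [RHS]mxE.
rewrite mxE [in leRHS]mxE mulr_sumr; apply: ler_sum => j _.
by rewrite mulrCA ler_pM2l.
Qed.

(** Fredholm alternative: [b] is in the range of [r - A] as soon as every left null vector of
    [r - A] kills it, and by [perron_unique] these are the multiples of [v]. *)
Lemma perron_fredholm n (A : 'M[R]_n) (r : R) (v : 'rV[R]_n) (b : 'cV[R]_n) :
  irreducible_mx A -> pos_mx v -> v *m A = r *: v -> v *m b = 0 ->
  exists y : 'cV[R]_n, r *: y - A *m y = b.
Proof.
move=> Ai v0 vA vb; pose M := r%:M - A.
have /submxP[y yE] : (b^T <= M^T)%MS.
  rewrite submxE; apply/eqP/matrixP => i j; rewrite [RHS]mxE.
  pose z := col j (cokermx M^T).
  have zA : z^T *m A = r *: z^T.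
    have : z^T *m M = 0.
      apply: trmx_inj.
      by rewrite trmx_mul trmxK /z colE mulmxA mulmx_coker mul0mx trmx0.
    by rewrite mulmxBr mul_mx_scalar => /eqP; rewrite subr_eq0 eq_sym => /eqP.
  have [k zk] := perron_unique Ai v0 vA zA.
  have -> : (b^T *m cokermx M^T) i j = (b^T *m z) i 0.
    by rewrite !mxE; apply: eq_bigr => l _; rewrite !mxE.
  by rewrite -[z]trmxK zk -trmx_mul -scalemxAl vb scaler0 !mxE.
exists y^T; apply: trmx_inj; rewrite yE linearB/= linearZ/= trmx_mul trmxK.
by rewrite /M linearB/= tr_scalar_mx mulmxBr mul_mx_scalar.
Qed.

(** The test vector is [w + e y], with [y] chosen to cancel the terms of order [e], so that the
    eigenvalue inequality holds up to [O(e^2)]. The coefficient [a] is the same for both signs of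
    [e]. *)
Lemma spectral_radius_perturb n (A D Q : 'M[R]_n.+1) (At : R -> 'M[R]_n.+1) :
  irreducible_mx A ->
  (forall e, `|e| <= 1 -> irreducible_mx (At e)) ->
  (forall e i j, `|e| <= 1 -> At e i j <= A i j + e * D i j + e ^+ 2 * Q i j) ->
  exists a C d, 0 < d /\ forall e, `|e| <= d ->
    spectral_radius (At e) <= spectral_radius A + a * e + C * e ^+ 2.
Proof.
move=> Ai Ati Atle; have [v [w [v0 w0 vA Aw]]] := perron Ai.
set rho := spectral_radius A in vA Aw *.
have vw0 := pos_dot v0 w0.
(* The value that makes [D w - a w] orthogonal to [v], as solvability for [y] requires. *)
pose a := (v *m D *m w) 0 0 / (v *m w) 0 0.
have [y yE] : exists y, rho *: y - A *m y = D *m w - a *: w.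
  apply: (perron_fredholm Ai v0 vA); apply/matrixP => i j.
  rewrite (ord1 i) (ord1 j) mulmxBr -scalemxAr mulmxA mxE [X in _ + X]mxE [X in _ - X]mxE.
  by rewrite /a divfK ?gt_eqF// subrr mxE.
have [C1 C10 yC] := dominate_pos (fun i => y i 0) (fun i => w0 i 0).
pose u i := `|(D *m y) i 0| + `|(Q *m w) i 0| + `|(Q *m y) i 0| + `|a * y i 0|.
have [C2 C20 uC] := dominate_pos u (fun i => w0 i 0).
exists a, (2 * C2), (Num.min 1 (2 * C1)^-1); split.
  by rewrite lt_min ltr01 invr_gt0 mulr_gt0.
move=> e; rewrite le_min => /andP[e1 eC1].
(* For this range of [e] the test vector stays above [w / 2]; hence the factor 2 in the constant
   [2 * C2]. *)
have ey i : w i 0 <= 2 * (w i 0 + e * y i 0).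
  have : `|e * y i 0| <= w i 0 / 2.
    rewrite normrM; apply: (le_trans (ler_pM _ _ eC1 (yC i))) => //.
    by rewrite invfM mulrA mulfVK ?gt_eqF// mulrC.
  rewrite ler_norml => /andP[+ _]; lra.
pose we := w + e *: y.
have weE i : we i 0 = w i 0 + e * y i 0 by rewrite !mxE.
have we0 : pos_mx we.
  by move=> i j; rewrite (ord1 j) weE; have := ey i; have := w0 i 0; lra.
apply: (spectral_radius_le (w := we)) => // [|i]; first exact: Ati.
apply: (@le_trans _ _ ((A *m we + e *: (D *m we) + e ^+ 2 *: (Q *m we)) i 0)).
  rewrite !scalemxAl -!mulmxDl mxE [leRHS]mxE; apply: ler_sum => j _.
  by apply: ler_wpM2r; [exact: ltW|rewrite !mxE; exact: Atle].
have -> : A *m we + e *: (D *m we) + e ^+ 2 *: (Q *m we) =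
    (rho + a * e) *: we + e ^+ 2 *: (D *m y + Q *m w + e *: (Q *m y) - a *: y).
  have DE : D *m w = rho *: y - A *m y + a *: w by rewrite yE addrNK.
  rewrite /we !mulmxDr -!scalemxAr DE Aw.
  apply/matrixP => k l.
  move: (A *m y) (D *m y) (Q *m w) (Q *m y) => X1 X2 X3 X4.
  rewrite !mxE; ring.
have uB : (D *m y + Q *m w + e *: (Q *m y) - a *: y) i 0 <= u i.
  move: (D *m y) (Q *m w) (Q *m y) @u uC => X2 X3 X4 u uC.
  rewrite !mxE /u; apply: lerD; first apply: lerD; first apply: lerD.
  - exact: ler_norm.
  - exact: ler_norm.
  - by apply: (le_trans (ler_norm _)); rewrite normrM ler_piMl.
  - by rewrite -normrN ler_norm.
rewrite mxE [X in X + _ <= _]mxE [X in _ + X <= _]mxE [leRHS]mulrDl lerD2l.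
rewrite [leRHS]mulrAC mulrC; apply: ler_wpM2r; first exact: sqr_ge0.
apply: (le_trans uB); apply: (le_trans (ler_norm _)); apply: (le_trans (uC i)).
rewrite [leRHS]mulrAC mulrC; apply: ler_wpM2r; first exact: ltW.
by rewrite weE.
Qed.

End Perron.

(** * Summation over a countable set *)

Section ExpIneq.
Variable R : realType.

Lemma expR_tangent (x y : R) : expR y * (1 + (x - y)) <= expR x.
Proof.
by rewrite -{2}(subrK y x) expRD mulrC ler_pM2r ?expR_gt0// expR_ge1Dx.
Qed.

Lemma expR_convex (k x y : R) : 0 <= k <= 1 ->
  expR ((1 - k) * x + k * y) <= (1 - k) * expR x + k * expR y.
Proof.
move=> /andP[k0 k1].
have := convex_expR (Itv01 k0 k1) y x.
by rewrite !convRE/= [(1 - k) * x + _]addrC [leRHS]addrC; apply.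
Qed.

Lemma expR_le_quadratic (u : R) : expR u <= 1 + u + u ^+ 2 * expR `|u|.
Proof.
have h : expR u - 1 <= u * expR u.
  have := expR_tangent 0 u; rewrite expR0; lra.
have h' := expR_ge1Dx u; have E0 := expR_gt0 u.
have [u0|u0] := leP 0 u.
  rewrite ger0_norm//; have := ler_wpM2l u0 h; lra.
have E1 : 1 <= expR `|u| by rewrite -[leLHS]expR0 ler_expR.
have := ler_wpM2l (sqr_ge0 u) E1; rewrite mulr1.
have : 0 <= - u * (expR u - 1 - u) by apply: mulr_ge0; lra.
lra.
Qed.

(** The factor 3 absorbs the square: [y ^+ 2] is at most [expR (2 |y|)], and [expR |e y|] at most
    [expR |y|]. Exponential moments then control the remainder. *)
Lemma expR_perturb (e y : R) : `|e| <= 1 ->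
  expR (e * y) <= 1 + e * y + e ^+ 2 * expR (3 * `|y|).
Proof.
move=> e1; apply: (le_trans (expR_le_quadratic _)).
rewrite lerD2l exprMn -mulrA ler_wpM2l ?sqr_ge0//.
have y1 : `|y| <= expR `|y| by apply: le_trans (expR_ge1Dx _); rewrite lerDr.
have -> : 3 * `|y| = `|y| + `|y| + `|y| by ring.
rewrite !expRD -[y ^+ 2]real_normK ?num_real//.
have ey : expR `|e * y| <= expR `|y| by rewrite ler_expR normrM ler_piMl.
apply: (ler_pM (sqr_ge0 _) (ltW (expR_gt0 _)) _ ey).
by rewrite expr2; apply: ler_pM.
Qed.

End ExpIneq.

(** * Real-valued sums of nonnegative families *)

Section Rsum.
Variables (R : realType) (T : choiceType).
Implicit Types f g : T -> R.

(** [fine] sends an infinite sum to [0], so finiteness is tracked separately by [rsummable]. *)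
Definition rsum f : R := fine (\esum_(x in [set: T]) (f x)%:E).

Definition rsummable f : Prop :=
  (forall x, 0 <= f x) /\ (\esum_(x in [set: T]) (f x)%:E < +oo)%E.

Lemma rsum_EFin f : rsummable f -> (\esum_(x in [set: T]) (f x)%:E)%E = (rsum f)%:E.
Proof.
move=> [f0 fs]; rewrite /rsum fineK// ge0_fin_numE//.
by apply: esum_ge0 => x _; rewrite lee_fin.
Qed.

Lemma le_rsummable f g : (forall x, 0 <= f x <= g x) -> rsummable g -> rsummable f.
Proof.
move=> fg [g0 gs]; split=> [x|]; first by have /andP[] := fg x.
apply: le_lt_trans gs; apply: le_esum => x _; rewrite lee_fin.
by have /andP[] := fg x.
Qed.

Lemma le_rsum f g : (forall x, 0 <= f x <= g x) -> rsummable g -> rsum f <= rsum g.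
Proof.
move=> fg gs; have fs := le_rsummable fg gs.
rewrite -lee_fin -!rsum_EFin//; apply: le_esum => x _; rewrite lee_fin.
by have /andP[] := fg x.
Qed.

Lemma rsum_ge0 f : (forall x, 0 <= f x) -> 0 <= rsum f.
Proof. by move=> f0; rewrite fine_ge0// esum_ge0// => x _; rewrite lee_fin. Qed.

Lemma rsum_ge f x : rsummable f -> f x <= rsum f.
Proof.
move=> fs; rewrite -lee_fin -rsum_EFin//; apply: esum_ge; exists [set x].
  by split.
by rewrite fsbig_set1.
Qed.

Lemma esumZ_le (k : R) f : 0 <= k -> (forall x, 0 <= f x) ->
  (\esum_(x in [set: T]) (k * f x)%:E <= k%:E * \esum_(x in [set: T]) (f x)%:E)%E.
Proof.
move=> k0 f0; apply: ge_ereal_sup => _ [X [finX XI] <-].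
under eq_fsbigr do rewrite EFinM.
rewrite -ge0_mule_fsumr; last by move=> x; rewrite lee_fin.
apply: lee_wpmul2l; first by rewrite lee_fin.
by apply: esum_ge; exists X.
Qed.

Lemma rsum_lin (a b : R) f g : 0 <= a -> 0 <= b -> rsummable f -> rsummable g ->
  rsummable (fun x => a * f x + b * g x) /\
  rsum (fun x => a * f x + b * g x) = a * rsum f + b * rsum g.
Proof.
have Z k h : 0 <= k -> rsummable h ->
    (\esum_(x in [set: T]) (k * h x)%:E)%E = (k * rsum h)%:E.
  move=> k0 hs; have [h0 _] := hs; apply/eqP; rewrite eq_le; apply/andP; split.
    by rewrite EFinM -rsum_EFin// esumZ_le.
  have [->|kn0] := eqVneq k 0.
    by rewrite mul0r esum_ge0// => x _; rewrite mul0r.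
  have kp : 0 < k by rewrite lt_neqAle eq_sym kn0.
  rewrite EFinM -lee_pdivlMl//.
  (* The reverse inequality is [esumZ_le] for the factor [1 / k], applied to [k * h]. *)
  have := @esumZ_le k^-1 (fun x => k * h x); rewrite invr_ge0 => /(_ k0).
  under eq_esum do rewrite mulKf//.
  by rewrite -rsum_EFin//; apply => x; rewrite mulr_ge0.
move=> a0 b0 fs gs; have [f0 _] := fs; have [g0 _] := gs.
have E : (\esum_(x in [set: T]) (a * f x + b * g x)%:E)%E = (a * rsum f + b * rsum g)%:E.
  under eq_esum do rewrite EFinD.
  rewrite esumD ?Z// => x _; by rewrite lee_fin mulr_ge0.
by split; [split; [move=> x; rewrite addr_ge0 ?mulr_ge0|rewrite E ltry]|rewrite /rsum E].
Qed.

End Rsum.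

(** * The Laplace transform of the jump kernel *)

Section Dot.
Variables (R : realType) (d : nat).
Implicit Types u v w : 'rV[R]_d.

Lemma dotvC u v : dotv u v = dotv v u.
Proof. by apply: eq_bigr => k _; rewrite mulrC. Qed.

Lemma dotvDl u v w : dotv (u + v) w = dotv u w + dotv v w.
Proof. by rewrite /dotv -big_split/=; apply: eq_bigr => k _; rewrite mxE mulrDl. Qed.

Lemma dotvZl a u v : dotv (a *: u) v = a * dotv u v.
Proof. by rewrite /dotv mulr_sumr; apply: eq_bigr => k _; rewrite mxE mulrA. Qed.

Lemma dotvDr u v w : dotv u (v + w) = dotv u v + dotv u w.
Proof. by rewrite dotvC dotvDl !(dotvC u). Qed.

Lemma dotvZr a u v : dotv u (a *: v) = a * dotv u v.
Proof. by rewrite dotvC dotvZl (dotvC u). Qed.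

Lemma dotv0l u : dotv 0 u = 0.
Proof. by rewrite -(scale0r 0) dotvZl mul0r. Qed.

Lemma dotvv_ge0 u : 0 <= dotv u u.
Proof. by apply: sumr_ge0 => k _; rewrite -expr2 sqr_ge0. Qed.

Lemma dotvv_eq0 u : dotv u u = 0 -> u = 0.
Proof.
move=> /eqP; rewrite psumr_eq0 => [/allP h|k _]; last by rewrite -expr2 sqr_ge0.
apply/rowP => k; rewrite mxE; have := h k (mem_index_enum _).
by rewrite mulf_eq0 orbb => /eqP.
Qed.

Lemma enorm_sqr u : enorm u ^+ 2 = dotv u u.
Proof. by rewrite sqr_sqrtr// dotvv_ge0. Qed.

Lemma coord_le_enorm u k : `|u 0 k| <= enorm u.
Proof.
rewrite -sqrtr_sqr ler_wsqrtr// /dotv (bigD1 k)//= -expr2 lerDl.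
by apply: sumr_ge0 => j _; rewrite -expr2 sqr_ge0.
Qed.

Lemma dotv_le_enorm u v : `|dotv u v| <= (\sum_k `|u 0 k|) * enorm v.
Proof.
apply: (le_trans (ler_norm_sum _ _ _)); rewrite mulr_suml; apply: ler_sum => k _.
by rewrite normrM; apply: ler_wpM2l => //; exact: coord_le_enorm.
Qed.

Lemma zvecB (x y : 'rV[int]_d) : zvec R (x - y) = zvec R x - zvec R y.
Proof. by apply/rowP => k; rewrite !mxE rmorphB. Qed.

Lemma zvecD (x y : 'rV[int]_d) : zvec R (x + y) = zvec R x + zvec R y.
Proof. by apply/rowP => k; rewrite !mxE rmorphD. Qed.

End Dot.

Lemma esum_fintype (R : realType) (I : finType) (f : I -> R) : (forall i, 0 <= f i) ->
  (\esum_(i in [set: I]) (f i)%:E = \sum_i (f i)%:E)%E.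
Proof.
move=> f0; rewrite esum_fset; [|exact: finite_finset|by move=> i _; rewrite lee_fin].
rewrite [RHS]fsbig_seq ?index_enum_uniq//; have -> // : [set` index_enum I] = [set: I].
by apply/seteqP; split=> i //= _; rewrite mem_index_enum.
Qed.

(** * The matrices [Lmu] and the function [rho] *)

Section Laplace.
Variables (R : realType) (d p : nat).
Variables (c : 'rV[int]_d -> 'I_p.+1 -> 'I_p.+1 -> R) (m : 'I_p.+1 -> R).
Hypothesis c_ge0 : forall x i j, 0 <= c x i j.
Hypothesis sigma_pos_fin : forall i, (0 < sigma c i < +oo)%E.
Hypothesis m_ge1 : forall i, 1 <= m i.
Hypothesis hA : assumptionA c m.

Lemma fine_sigma_gt0 i : 0 < fine (sigma c i).
Proof. by rewrite fine_gt0. Qed.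

Lemma m_gt0 i : 0 < m i.
Proof. exact: lt_le_trans ltr01 (m_ge1 i). Qed.

Lemma mu_ge0 i j x : 0 <= mu c m i j x.
Proof. by rewrite divr_ge0// mulr_ge0// ltW ?m_gt0 ?fine_sigma_gt0. Qed.

Lemma rsummable_exp i j (g : 'rV[int]_d -> R) (C : R) :
  (forall x, g x <= C * enorm (zvec R x)) ->
  rsummable (fun x => expR (g x) * mu c m i j x).
Proof.
move=> gC; have [_ _ _ hE] := hA.
(* [exp_moments] asks for a positive exponent, while [C] may have any sign. *)
have C0 : 0 < `|C| + 1 by rewrite ltr_wpDl.
apply: (@le_rsummable _ _ _ (fun x => expR ((`|C| + 1) * enorm (zvec R x)) * mu c m i j x)).
  move=> x; rewrite mulr_ge0 ?expR_ge0 ?mu_ge0//= ler_wpM2r ?mu_ge0// ler_expR.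
  apply: (le_trans (gC x)); apply: ler_wpM2r; first exact: sqrtr_ge0.
  by apply: (le_trans (ler_norm _)); rewrite lerDl.
by split; [move=> x; rewrite mulr_ge0 ?expR_ge0 ?mu_ge0|exact: hE].
Qed.

Lemma LmuE t i j :
  Lmu c m t i j = rsum (fun x => expR (dotv t (zvec R x)) * mu c m i j x).
Proof. by rewrite mxE. Qed.

Lemma rsummable_Lmu t i j :
  rsummable (fun x => expR (dotv t (zvec R x)) * mu c m i j x).
Proof.
apply: (@rsummable_exp _ _ _ (\sum_k `|t 0 k|)) => x.
exact: le_trans (ler_norm _) (dotv_le_enorm _ _).
Qed.

Lemma Lmu_ge0 t : nonneg_mx (Lmu c m t).
Proof.
by move=> i j; rewrite LmuE; apply: rsum_ge0 => x; rewrite mulr_ge0 ?expR_ge0 ?mu_ge0.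
Qed.

Lemma krw_step_ge0 s s' : 0 <= krw_step c m s s'.
Proof.
case: s s' => [[x i]|] [[y j]|] //=; first exact: mu_ge0.
by rewrite subr_ge0 invf_le1 ?m_gt0.
Qed.

Lemma krw_prob_ge0 n s s' : (0 <= krw_prob c m n s s')%E.
Proof.
elim: n s => [|n IH] s /=; first by rewrite lee_fin ler0n.
by apply: esum_ge0 => z _; rewrite mule_ge0// lee_fin krw_step_ge0.
Qed.

Lemma krw_prob_cemetery n s : krw_prob c m n None (Some s) = 0%E.
Proof.
elim: n => [//|n IH] /=; apply: esum1 => -[z|] _; first by rewrite /= mul0e.
by rewrite IH mule0.
Qed.

(** A path of positive probability from [(x, i)] to [(y, j)] contributes its probability times
    [expR (t . (y - x))] to the matrix power. As [q] does not depend on [t], this yields the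
    boundedness of the sublevel set as well as irreducibility. *)
Lemma krw_prob_Lmu n x i y j :
  (0 < krw_prob c m n (Some (x, i)) (Some (y, j)))%E ->
  exists2 q, 0 < q & forall t, q * expR (dotv t (zvec R (y - x))) <= (Lmu c m t ^+ n) i j.
Proof.
elim: n x i => [|n IH] x i /=.
  rewrite lte_fin ltr0n lt0b => /eqP[-> ->]; exists 1 => // t.
  rewrite subrr expr0 mxE eqxx mul1r.
  have -> : zvec R (0 : 'rV[int]_d) = 0 by apply/rowP => k; rewrite !mxE.
  by rewrite dotvC dotv0l expR0.
move=> P0.
have [z zP] : exists z, ((krw_step c m (Some (x, i)) z)%:E *
    krw_prob c m n z (Some (y, j)) <> 0)%E.
  apply/existsNP => h; move: P0; rewrite esum1 ?ltxx// => z _; exact: h.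
case: z zP => [[z k]|]; last by rewrite krw_prob_cemetery mule0.
move=> /eqP; rewrite mule_eq0 negb_or eqe => /andP[s0 p0].
have mu0 : 0 < mu c m i k (z - x) by rewrite lt_neqAle eq_sym s0 mu_ge0.
have [|q q0 qP] := IH z k; first by rewrite lt_neqAle eq_sym p0 krw_prob_ge0.
exists (mu c m i k (z - x) * q); first exact: mulr_gt0.
move=> t; rewrite exprS -mulmxE mxE.
apply: (@le_trans _ _ (Lmu c m t i k * (Lmu c m t ^+ n) k j)); last first.
  rewrite (bigD1 k)//= lerDl; apply: sumr_ge0 => l _.
  by rewrite mulr_ge0 ?Lmu_ge0//; exact/nonneg_expmx/Lmu_ge0.
have -> : y - x = (z - x) + (y - z) by rewrite [RHS]addrC subrKA.
rewrite zvecD dotvDr expRD mulrACA; apply: ler_pM => //.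
- by rewrite mulr_ge0 ?expR_ge0 ?mu_ge0.
- by rewrite mulr_ge0 ?expR_ge0// ltW.
- rewrite mulrC LmuE.
  exact: (rsum_ge (z - x) (rsummable_Lmu t i k)).
Qed.

Lemma Lmu_irreducible t : irreducible_mx (Lmu c m t).
Proof.
split=> [|i j]; first exact: Lmu_ge0.
have [_ /(_ i j 0)[n _ /krw_prob_Lmu[q q0 qP]] _ _] := hA.
by exists n; apply: lt_le_trans (qP t); rewrite mulr_gt0 ?expR_gt0.
Qed.

(** The test vector is the weighted geometric mean of the Perron vectors at [t1] and [t2]. Each
    exponential in [(L w)_i / w_i] then has a convex combination as its exponent, and convexity of
    [expR] applies term by term. *)
Lemma rho_convex (k : R) t1 t2 : 0 <= k <= 1 ->
  rho c m ((1 - k) *: t1 + k *: t2) <= (1 - k) * rho c m t1 + k * rho c m t2.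
Proof.
move=> k01; have /andP[k0 k1] := k01.
have k1' : 0 <= 1 - k by rewrite subr_ge0.
have [_ [w1 [_ w10 _ Aw1]]] := perron (Lmu_irreducible t1).
have [_ [w2 [_ w20 _ Aw2]]] := perron (Lmu_irreducible t2).
pose f i := (1 - k) * ln (w1 i 0) + k * ln (w2 i 0).
apply: (spectral_radius_le (w := \col_i expR (f i))).
- exact: Lmu_irreducible.
- by move=> i j; rewrite mxE expR_gt0.
move=> i; rewrite [in leRHS]mxE -ler_pdivrMr ?expR_gt0// mxE mulr_suml.
have e1 : rho c m t1 = \sum_j Lmu c m t1 i j * (w1 j 0 / w1 i 0).
  have := congr1 (fun z : 'cV[R]_p.+1 => z i 0 / w1 i 0) Aw1.
  rewrite mxE [in RHS]mxE mulfK ?gt_eqF// /rho => <-.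
  by rewrite mulr_suml; apply: eq_bigr => j _; rewrite mulrA.
have e2 : rho c m t2 = \sum_j Lmu c m t2 i j * (w2 j 0 / w2 i 0).
  have := congr1 (fun z : 'cV[R]_p.+1 => z i 0 / w2 i 0) Aw2.
  rewrite mxE [in RHS]mxE mulfK ?gt_eqF// /rho => <-.
  by rewrite mulr_suml; apply: eq_bigr => j _; rewrite mulrA.
rewrite e1 e2 !mulr_sumr -big_split/=; apply: ler_sum => j _.
rewrite mxE -mulrA -expRN -expRD.
pose a1 := ln (w1 j 0) - ln (w1 i 0); pose a2 := ln (w2 j 0) - ln (w2 i 0).
have -> : w1 j 0 / w1 i 0 = expR a1.
  by rewrite expRD expRN !lnK ?posrE.
have -> : w2 j 0 / w2 i 0 = expR a2.
  by rewrite expRD expRN !lnK ?posrE.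
rewrite !LmuE.
have s1 := rsummable_Lmu t1 i j; have s2 := rsummable_Lmu t2 i j.
have b1 : 0 <= (1 - k) * expR a1 by rewrite mulr_ge0 ?expR_ge0.
have b2 : 0 <= k * expR a2 by rewrite mulr_ge0 ?expR_ge0.
have [ss E] := rsum_lin b1 b2 s1 s2.
have -> : (1 - k) * (rsum (fun x => expR (dotv t1 (zvec R x)) * mu c m i j x) * expR a1) +
   k * (rsum (fun x => expR (dotv t2 (zvec R x)) * mu c m i j x) * expR a2) =
   (1 - k) * expR a1 * rsum (fun x => expR (dotv t1 (zvec R x)) * mu c m i j x) +
   k * expR a2 * rsum (fun x => expR (dotv t2 (zvec R x)) * mu c m i j x) by ring.
set t := (1 - k) *: t1 + k *: t2.
(* [rsum_lin] with second coefficient [0] moves the factor [expR (f j - f i)] into the sum. *)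
have e0 : 0 <= expR (f j - f i) by exact: expR_ge0.
have [_ E'] := rsum_lin e0 (lexx 0) (rsummable_Lmu t i j) (rsummable_Lmu t i j).
rewrite -E -[leLHS]addr0.
rewrite -[X in _ + X <= _](mul0r (rsum (fun x => expR (dotv t (zvec R x)) * mu c m i j x))).
rewrite [X in X + _ <= _]mulrC -E'; apply: le_rsum => // x.
have := mu_ge0 i j x; move: (mu c m i j x) => M M0.
rewrite mul0r addr0 !mulrA -mulrDl !mulr_ge0 ?expR_ge0//=.
apply: ler_wpM2r => //.
rewrite -expRD -!mulrA -!expRD.
have -> : f j - f i + dotv t (zvec R x) =
    (1 - k) * (a1 + dotv t1 (zvec R x)) + k * (a2 + dotv t2 (zvec R x)).
  by rewrite /f /t /a1 /a2 dotvDl !dotvZl; ring.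
exact: expR_convex.
Qed.

Lemma Lmu_perturb t h : exists D Q : 'M[R]_p.+1, forall e i j, `|e| <= 1 ->
  Lmu c m (t + e *: h) i j <= Lmu c m t i j + e * D i j + e ^+ 2 * Q i j.
Proof.
pose y x := dotv h (zvec R x).
pose f s i j x := expR (dotv s (zvec R x)) * mu c m i j x.
pose q i j x := expR (dotv t (zvec R x) + 3 * `|y x|) * mu c m i j x.
(* The derivative kernel has the sign of [y]. Adding [expR (3 |y|)], which exceeds [|y|], makes [r]
   nonnegative, and the derivative is recovered as the sum of [r] minus the sum of [q]. *)
pose r i j x := expR (dotv t (zvec R x)) * (y x + expR (3 * `|y x|)) * mu c m i j x.
have y3 x : `|y x| <= expR (3 * `|y x|).
  apply: le_trans (expR_ge1Dx _); have := normr_ge0 (y x); lra.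
have yge0 x : 0 <= y x + expR (3 * `|y x|).
  by have := y3 x; rewrite ler_norml => /andP[+ _]; lra.
have qs i j : rsummable (q i j).
  apply: (@rsummable_exp _ _ _ ((\sum_k `|t 0 k|) + 3 * \sum_k `|h 0 k|)) => x.
  rewrite [leRHS]mulrDl; apply: lerD; last rewrite -mulrA.
    exact: le_trans (ler_norm _) (dotv_le_enorm _ _).
  by rewrite ler_pM2l// dotv_le_enorm.
have rs i j : rsummable (r i j).
  have [qqs _] := rsum_lin ler01 ler01 (qs i j) (qs i j).
  apply: le_rsummable qqs => x.
  rewrite /r /q; have := mu_ge0 i j x; move: (mu c m i j x) => M M0.
  rewrite !mulr_ge0 ?expR_ge0//= !mul1r -mulrDl.
  rewrite ler_wpM2r// expRD -mulrDr ler_wpM2l ?expR_ge0// lerD2r.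
  exact: le_trans (ler_norm _) (y3 x).
have fs s i j : rsummable (f s i j) by exact: rsummable_Lmu.
have LE s i j : Lmu c m s i j = rsum (f s i j) by exact: LmuE.
pose D : 'M[R]_p.+1 := \matrix_(i, j) (rsum (r i j) - rsum (q i j)).
pose Q : 'M[R]_p.+1 := \matrix_(i, j) rsum (q i j).
have DE i j : D i j = rsum (r i j) - rsum (q i j) by rewrite mxE.
have QE i j : Q i j = rsum (q i j) by rewrite mxE.
exists D, Q; move: D Q DE QE => D Q DE QE e i j e1; rewrite !DE !QE !LE.
(* Adding [r + (1 + e) q] on both sides makes every summand nonnegative. *)
have e0 : 0 <= 1 + e by move: e1; rewrite ler_norml => /andP[+ _]; lra.
have e2 : 0 <= 1 + e ^+ 2 by rewrite addr_ge0// sqr_ge0.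
have [ls1 lE1] := rsum_lin ler01 e0 (rs i j) (qs i j).
have [ls2 lE2] := rsum_lin ler01 ler01 (fs (t + e *: h) i j) ls1.
have [rs1 rE1] := rsum_lin e0 e2 (rs i j) (qs i j).
have [rs2 rE2] := rsum_lin ler01 ler01 (fs t i j) rs1.
have := le_rsum _ rs2.
move=> /(_ (fun x => 1 * f (t + e *: h) i j x + 1 * (1 * r i j x + (1 + e) * q i j x))).
rewrite lE2 lE1 rE2 rE1 => H.
suff : forall x, 0 <= 1 * f (t + e *: h) i j x + 1 * (1 * r i j x + (1 + e) * q i j x) <=
    1 * f t i j x + 1 * ((1 + e) * r i j x + (1 + e ^+ 2) * q i j x).
  by move=> /H; lra.
move=> x; have [l0 _] := ls2; rewrite l0/=.
have := expR_perturb (y x) e1.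
rewrite /f /q /r; have := mu_ge0 i j x; move: (mu c m i j x) => M M0.
rewrite dotvDl dotvZl -/(y x) !expRD => H1.
have := ler_wpM2l (mulr_ge0 (expR_ge0 (dotv t (zvec R x))) M0) H1.
move: (expR (dotv t (zvec R x))) (expR (3 * `|y x|)) (expR (e * y x)) => X Y Z.
lra.
Qed.

Lemma rho_perturb t h : exists a C d, 0 < d /\ forall e, `|e| <= d ->
  rho c m (t + e *: h) <= rho c m t + a * e + C * e ^+ 2.
Proof.
have [D [Q DQ]] := Lmu_perturb t h.
apply: (spectral_radius_perturb (D := D) (Q := Q) (At := fun e => Lmu c m (t + e *: h))).
- exact: Lmu_irreducible.
- by move=> e _; exact: Lmu_irreducible.
- by move=> e i j e1; exact: DQ.
Qed.

(** At [t = 0] the exponential weights are 1, and the total over all jumps from type [i] is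
    [sigma_i / (m_i sigma_i)]. *)
Lemma Lmu0_row_sum i : \sum_j Lmu c m 0 i j <= (m i)^-1.
Proof.
have m0 := m_gt0 i; have s0 := fine_sigma_gt0 i.
have sE : (sigma c i = (fine (sigma c i))%:E)%E.
  by rewrite fineK// ge0_fin_numE ?ltW//; have /andP[] := sigma_pos_fin i.
have k0 : 0 <= (m i * fine (sigma c i))^-1 by rewrite invr_ge0 mulr_ge0 ?ltW.
rewrite -lee_fin -sumEFin.
rewrite (eq_bigr (fun j => \esum_(x in [set: 'rV[int]_d])
    (expR (dotv 0 (zvec R x)) * mu c m i j x)%:E)%E); last first.
  by move=> j _; rewrite LmuE rsum_EFin//; exact: rsummable_Lmu.
rewrite -esum_sum; last first.
  by move=> x j _ _; rewrite lee_fin; apply: mulr_ge0; [exact: expR_ge0|exact: mu_ge0].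
apply: (@le_trans _ _ (\esum_(x in [set: 'rV[int]_d])
    ((m i * fine (sigma c i))^-1 * \sum_j c x i j)%:E)%E).
  apply: le_esum => x _; rewrite sumEFin lee_fin mulr_sumr; apply: ler_sum => j _.
  by rewrite dotv0l expR0 mul1r mulrC.
apply: (le_trans (esumZ_le _ _)) => //; first by move=> x; apply: sumr_ge0.
have -> : (\esum_(x in [set: 'rV[int]_d]) (\sum_j c x i j)%:E = sigma c i)%E.
  under eq_esum => x _.
    rewrite -sumEFin.
    have -> : (\sum_j (c x i j)%:E)%E = (\esum_(j in [set: 'I_p.+1]) (c x i j)%:E)%E.
      by rewrite esum_fintype.
    over.
  rewrite esum_esum//; last by move=> *; rewrite lee_fin.
  rewrite /sigma; congr esum; apply/seteqP; split=> //.
rewrite sE -EFinM lee_fin invfM mulfVK ?gt_eqF//.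
Qed.

(** Pair the left Perron vector with the all-one vector: [rho 0] is an average of row sums with
    positive weights, and the bounds [1 / m_j] on these are at most 1, one of them strictly less. *)
Lemma rho0_lt1 : rho c m 0 < 1.
Proof.
have [v [_ [v0 _ vA _]]] := perron (Lmu_irreducible 0).
have [[i mi] _ _ _] := hA.
have V0 : 0 < \sum_j v 0 j.
  by rewrite (bigD1 i)//= ltr_pwDl// sumr_ge0// => j _; exact: ltW.
rewrite -(ltr_pM2r V0) mul1r.
have -> : rho c m 0 * \sum_j v 0 j = \sum_j v 0 j * \sum_k Lmu c m 0 j k.
  rewrite mulr_sumr.
  under [RHS]eq_bigr do rewrite mulr_sumr.
  rewrite exchange_big/=; apply: eq_bigr => k _.
  by have := congr1 (fun z : 'rV[R]_p.+1 => z 0 k) vA; rewrite !mxE => ->.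
apply: (@le_lt_trans _ _ (\sum_j v 0 j * (m j)^-1)).
  by apply: ler_sum => j _; rewrite ler_pM2l// Lmu0_row_sum.
rewrite (bigD1 i)//= [ltRHS](bigD1 i)//=; apply: ltr_leD.
  by rewrite gtr_pMr// invf_lt1 ?m_gt0.
by apply: ler_sum => j _; apply: ler_piMr; [exact: ltW|rewrite invf_le1 ?m_gt0].
Qed.

(** By irreducibility the walk can go from [(0, 0)] to [(x, 0)], so
    [q expR (t . x) <= (L^n)_00 <= rho^n <= 1], which bounds [t . x]. Then [x] is taken to be plus
    and minus a basis vector. *)
Lemma rho_le1_bounded k : exists M, forall t, rho c m t <= 1 -> `|t 0 k| <= M.
Proof.
have H (x : 'rV[int]_d) : exists M, forall t, rho c m t <= 1 -> dotv t (zvec R x) <= M.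
  have [_ /(_ 0 0 x)[n _ /krw_prob_Lmu[q q0 qP]] _ _] := hA.
  exists (- ln q) => t t1; have := qP t; rewrite subr0 => {}qP.
  have [_ [w [_ w0 _ Aw]]] := perron (Lmu_irreducible t).
  rewrite -/(rho c m t) in Aw.
  have r0 : 0 <= rho c m t.
    rewrite -(pmulr_lge0 _ (w0 0 0)).
    have := congr1 (fun z : 'cV[R]_p.+1 => z 0 0) Aw; rewrite [in RHS]mxE mulrC => <-.
    by apply: nonneg_mulmx; [exact: Lmu_ge0|move=> i j; exact: ltW].
  have An : Lmu c m t ^+ n *m w = rho c m t ^+ n *: w.
    elim: (n) => [|l IH]; first by rewrite !expr0 mul1mx scale1r.
    by rewrite exprSr -mulmxE -mulmxA Aw -scalemxAr IH scalerA -exprS.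
  have : (Lmu c m t ^+ n) 0 0 * w 0 0 <= w 0 0.
    apply: (@le_trans _ _ ((Lmu c m t ^+ n *m w) 0 0)).
      rewrite [leRHS]mxE (bigD1 0)//= lerDl; apply: sumr_ge0 => j _.
      by rewrite mulr_ge0 ?(ltW (w0 _ _))//; exact/nonneg_expmx/Lmu_ge0.
    by rewrite An mxE ler_piMl ?(ltW (w0 _ _))// exprn_ile1.
  rewrite -[leRHS]mul1r ler_pM2r ?w0// => /(le_trans qP).
  by rewrite -{1}(lnK (x := q)) ?posrE// -expRD -expR0 ler_expR; lra.
have [M1 h1] := H (delta_mx 0 k); have [M2 h2] := H (- delta_mx 0 k).
have dE (t : 'rV[R]_d) : dotv t (zvec R (delta_mx 0 k)) = t 0 k.
  rewrite /dotv (bigD1 k)//= big1 ?addr0; first by rewrite !mxE !eqxx mulr1.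
  by move=> j /negPf jk; rewrite !mxE eqxx jk mulr0.
exists (Num.max M1 M2) => t t1; rewrite ler_norml lerNl !le_max.
have := h1 t t1; rewrite dE => ->.
have := h2 t t1; rewrite -[- _]add0r zvecB dotvDr -scaleN1r dotvZr dE.
have -> : zvec R (0 : 'rV[int]_d) = 0 by apply/rowP => l; rewrite !mxE.
by rewrite dotvC dotv0l add0r mulN1r => ->; rewrite orbT.
Qed.

End Laplace.

(** * Gauss map and polar of the sublevel set of a convex function *)

Section Topo.
Variables (R : realType) (d : nat).

Lemma dotv_continuous (u : 'rV[R]_d) : continuous (dotv u).
Proof.
rewrite (_ : dotv u = fun v => \sum_k u 0 k * v 0 k)//.
apply: continuous_sum => k v.
by apply: continuous_comp; [exact: coord_continuous|exact: mulrl_continuous].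
Qed.

Lemma coord_le_norm (v : 'rV[R]_d) k : `|v 0 k| <= `|v|.
Proof.
rewrite [leRHS]/Num.norm /= mx_normrE.
exact: (le_bigmax _ (fun i : 'I_1 * 'I_d => `|v i.1 i.2|) (0, k)).
Qed.

Lemma closed_dotv_le (u : 'rV[R]_d) (b : R) : closed [set v | dotv u v <= b].
Proof.
apply: (@closed_comp _ _ (dotv u) [set y | y <= b]); last exact: closed_le.
by move=> v _; exact: dotv_continuous.
Qed.

(** Evaluate at a small [e] of the sign of [b]. This identifies first-order coefficients from an
    inequality valid for both signs of [e]. *)
Lemma linear_le_quadratic_eq0 (b C r : R) : 0 < r ->
  (forall e, `|e| <= r -> b * e <= C * e ^+ 2) -> b = 0.
Proof.
move=> r0 h; apply/eqP/negPn/negP => bn0.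
have b0 : 0 < `|b| by rewrite normr_gt0.
pose e := Num.min r (`|b| / (2 * (`|C| + 1))).
have C1 : 0 < `|C| + 1 by rewrite ltr_wpDl.
have e0 : 0 < e by rewrite lt_min r0 divr_gt0// mulr_gt0.
have eC : e * (2 * (`|C| + 1)) <= `|b|.
  by rewrite -ler_pdivlMr ?mulr_gt0// /e ge_min lexx orbT.
have := h (Num.sg b * e); rewrite normrM normr_sg bn0 mul1r gtr0_norm//.
have er : e <= r by rewrite /e ge_min lexx.
move=> /(_ er); rewrite mulrA [b * _]mulrC -normrEsg exprMn sqr_sg bn0 mul1r.
rewrite expr2 mulrA ler_pM2r// => bC.
have := ler_norm C; have := normr_ge0 C.
move: (`|C|) (`|b|) bC eC b0 C1 => c b' bC eC b0 C1 c0 cC; nra.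
Qed.

End Topo.

(** * First-order calculus for a convex function *)

Section ConvexGradient.
Variables (R : realType) (d : nat) (f : 'rV[R]_d -> R).
Hypothesis f_convex : forall (k : R) t1 t2, 0 <= k <= 1 ->
  f ((1 - k) *: t1 + k *: t2) <= (1 - k) * f t1 + k * f t2.
Hypothesis f_perturb : forall t h, exists a C r, 0 < r /\ forall e, `|e| <= r ->
  f (t + e *: h) <= f t + a * e + C * e ^+ 2.

(** If the line were above [f] at [t + e h] by [D], convexity between that point and [t - s e h]
    would force [f] above the line by [s D] at the latter, against an allowance of order [s^2]. *)
Lemma tangent_line t h : exists a C r, [/\ 0 < r,
  (forall e, f t + a * e <= f (t + e *: h)) &
  (forall e, `|e| <= r -> f (t + e *: h) <= f t + a * e + C * e ^+ 2)].
Proof.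
have [a [C [r [r0 fr]]]] := f_perturb t h.
exists a, C, r; split=> // e.
have [->|en0] := eqVneq e 0; first by rewrite mulr0 addr0 scale0r addr0.
rewrite leNgt; apply/negP => lt.
set D := f t + a * e - f (t + e *: h).
have D0 : 0 < D by rewrite subr_gt0.
have e0 : 0 < `|e| by rewrite normr_gt0.
have C1 : 0 < `|C| * e ^+ 2 + 1 by rewrite ltr_wpDl// mulr_ge0// sqr_ge0.
(* The first bound keeps [s e] in the range of [f_perturb], the second makes the quadratic term less
   than [s D]. *)
pose s := Num.min (r / `|e|) (D / (2 * (`|C| * e ^+ 2 + 1))).
have s0 : 0 < s by rewrite lt_min !divr_gt0// mulr_gt0.
have sr : `|- (s * e)| <= r.
  by rewrite normrN normrM gtr0_norm// -ler_pdivlMr// /s ge_min lexx.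
have sD : s * (2 * (`|C| * e ^+ 2 + 1)) <= D.
  by rewrite -ler_pdivlMr ?mulr_gt0// /s ge_min lexx orbT.
have s1 : 0 < 1 + s by lra.
have k01 : 0 <= (1 + s)^-1 <= 1 by rewrite invr_ge0 ltW//= invf_le1//; lra.
have := f_convex (t + e *: h) (t + (- (s * e)) *: h) k01.
have -> : (1 - (1 + s)^-1) *: (t + e *: h) + (1 + s)^-1 *: (t + - (s * e) *: h) = t.
  by apply/matrixP => i j; rewrite !mxE; field; lra.
rewrite -(ler_pM2r s1).
have -> : ((1 - (1 + s)^-1) * f (t + e *: h) + (1 + s)^-1 * f (t + - (s * e) *: h)) * (1 + s)
  = s * f (t + e *: h) + f (t + - (s * e) *: h) by field; lra.
move=> h1; have h2 := fr _ sr.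
have h3 : s * D <= C * e ^+ 2 * s * s by rewrite /D; lra.
rewrite [C * _ * _ * s]mulrC ler_pM2l// in h3.
have := ler_wpM2r (sqr_ge0 e) (ler_norm C).
move: (C * e ^+ 2) (`|C| * e ^+ 2) h3 sD C1 => x y h3 sD C1 xy.
nra.
Qed.

Lemma derive_tangent t h a C r : 0 < r ->
  (forall e, f t + a * e <= f (t + e *: h)) ->
  (forall e, `|e| <= r -> f (t + e *: h) <= f t + a * e + C * e ^+ 2) ->
  'D_h f t = a.
Proof.
move=> r0 lo up; apply/cvg_lim => //.
apply/cvgrPdist_le => eps eps0; near=> e.
have en0 : e != 0 by near: e; exact: nbhs_dnbhs_neq.
have er : `|e| <= r.
  near: e; apply: dnbhs0_le; exact: r0.
have eC : `|e| * (`|C| + 1) <= eps.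
  rewrite -ler_pdivlMr; last by rewrite ltr_wpDl.
  by near: e; apply: dnbhs0_le; rewrite divr_gt0// ltr_wpDl.
rewrite /= [e *: h + t]addrC.
have h1 := lo e; have h2 := up e er.
have -> : a - e^-1 *: (f (t + e *: h) - f t) = - (e^-1 * (f (t + e *: h) - f t - a * e)).
  by rewrite mulrBr [a * e]mulrC mulKf// opprB.
rewrite normrN normrM normfV ler_pdivrMl ?normr_gt0//.
rewrite ger0_norm; last by lra.
have : f (t + e *: h) - f t - a * e <= C * e ^+ 2 by lra.
move/le_trans; apply; rewrite -real_normK ?num_real// expr2.
rewrite mulrCA; apply: ler_wpM2l => //; apply: le_trans eC.
rewrite mulrC; apply: ler_wpM2l => //; have := ler_norm C; lra.
Unshelve. all: by end_near. Qed.

Lemma deriveP t h : exists C r, [/\ 0 < r,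
  (forall e, f t + 'D_h f t * e <= f (t + e *: h)) &
  (forall e, `|e| <= r -> f (t + e *: h) <= f t + 'D_h f t * e + C * e ^+ 2)].
Proof.
have [a [C [r [r0 lo up]]]] := tangent_line t h.
by rewrite (derive_tangent r0 lo up); exists C, r.
Qed.

Lemma deriveZ_dir t c h : 'D_(c *: h) f t = c * 'D_h f t.
Proof.
have [C1 [r1 [r10 lo1 up1]]] := deriveP t h.
have [C2 [r2 [r20 lo2 up2]]] := deriveP t (c *: h).
have c0 : 0 < `|c| + 1 by rewrite ltr_wpDl.
apply/eqP; rewrite -subr_eq0; apply/eqP.
apply: (@linear_le_quadratic_eq0 _ _ (C1 * c ^+ 2) (r1 / (`|c| + 1))).
  by rewrite divr_gt0.
move=> e; rewrite ler_pdivlMr// => er.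
have := lo2 e; rewrite scalerA => h1.
have : `|e * c| <= r1.
  by rewrite normrM; apply: le_trans er; rewrite ler_wpM2l// lerDl.
move=> /up1; rewrite exprMn; lra.
Qed.

(** [t + e (h1 + h2)] is the midpoint of [t + 2 e h1] and [t + 2 e h2], so convexity compares the
    derivatives to first order, and the two signs of [e] give equality. *)
Lemma deriveD_dir t h1 h2 : 'D_(h1 + h2) f t = 'D_h1 f t + 'D_h2 f t.
Proof.
have [C1 [r1 [r10 lo1 up1]]] := deriveP t h1.
have [C2 [r2 [r20 lo2 up2]]] := deriveP t h2.
have [C3 [r3 [r30 lo3 up3]]] := deriveP t (h1 + h2).
apply/eqP; rewrite -subr_eq0; apply/eqP.
apply: (@linear_le_quadratic_eq0 _ _ (2 * (C1 + C2)) (Num.min r1 r2 / 2)).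
  by rewrite divr_gt0// lt_min r10.
move=> e; rewrite ler_pdivlMr// le_min => /andP[er1 er2].
have l3 := lo3 e.
have u1 : `|e * 2| <= r1 by rewrite normrM (@ger0_norm _ 2).
have u2 : `|e * 2| <= r2 by rewrite normrM (@ger0_norm _ 2).
have {}u1 := up1 _ u1; have {}u2 := up2 _ u2.
have k01 : 0 <= (2^-1 : R) <= 1 by lra.
have := f_convex (t + (e * 2) *: h1) (t + (e * 2) *: h2) k01.
have -> : (1 - 2^-1) *: (t + (e * 2) *: h1) + 2^-1 *: (t + (e * 2) *: h2) = t + e *: (h1 + h2).
  by apply/matrixP => i j; rewrite !mxE; field.
lra.
Qed.

Lemma derive_grad t h : 'D_h f t = dotv (grad f t) h.
Proof.
rewrite {1}[h]row_sum_delta /dotv.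
elim/big_rec2 : _ => [|k y1 y2 _ <-].
  by rewrite -(scale0r 0) deriveZ_dir mul0r.
by rewrite deriveD_dir deriveZ_dir mxE mulrC.
Qed.

Lemma subgradient t s : f t + dotv (grad f t) (s - t) <= f s.
Proof.
have [C [r [_ lo _]]] := deriveP t (s - t).
by have := lo 1; rewrite mulr1 scale1r subrKC derive_grad.
Qed.

(** By the subgradient inequality the sublevel set is an intersection of closed half-spaces; a point
    [s] with [f s > b] is excluded by the half-space at [t = s]. *)
Lemma closed_sublevel b : closed [set t | f t <= b].
Proof.
have -> : [set t | f t <= b] = \bigcap_(t in setT)
    [set s | dotv (grad f t) s <= b - f t + dotv (grad f t) t].
  apply/seteqP; split=> s /=.
    move=> fs t _ /=; have := subgradient t s.
    rewrite dotvDr -scaleN1r dotvZr; lra.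
  by move=> /(_ s I) /=; lra.
by apply: closed_bigI => t _; exact: closed_dotv_le.
Qed.

(** * Gauss map of the level set *)

Hypothesis f0 : f 0 < 1.
Hypothesis f_bounded : forall k, exists M, forall t, f t <= 1 -> `|t 0 k| <= M.

Lemma sublevel_compact : compact [set t | f t <= 1].
Proof.
have [M MP] := choice f_bounded.
apply: (subclosed_compact (closed_sublevel (b := 1))
  (@rV_compact _ d (fun k => `[- M k, M k]%classic) _)).
  by move=> k; exact: segment_compact.
by move=> t /= ft k; rewrite /= in_itv/= -ler_norml MP.
Qed.

(** The subgradient inequality at [t], evaluated at the origin. *)
Lemma dotv_grad_gt0 t : f t = 1 -> 0 < dotv t (grad f t).
Proof.
move=> ft; have := subgradient t 0; rewrite sub0r -scaleN1r dotvZr dotvC ft.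
have := f0; lra.
Qed.

Lemma enorm_grad_gt0 t : f t = 1 -> 0 < enorm (grad f t).
Proof.
move=> ft; rewrite lt_neqAle eq_sym sqrtr_ge0 andbT; apply/eqP => n0.
have : dotv (grad f t) (grad f t) = 0 by rewrite -enorm_sqr n0 expr0n.
move=> /dotvv_eq0 g0; have := dotv_grad_gt0 ft.
by rewrite g0 dotvC dotv0l ltxx.
Qed.

Definition gauss t := (enorm (grad f t))^-1 *: grad f t.

Lemma gauss_support t s : f t = 1 -> f s <= 1 ->
  dotv s (gauss t) <= dotv t (gauss t).
Proof.
move=> ft fs; have n0 := enorm_grad_gt0 ft.
rewrite /gauss !dotvZr ler_pM2l ?invr_gt0//.
have := subgradient t s; rewrite ft dotvDr -scaleN1r dotvZr !(dotvC (grad f t)).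
lra.
Qed.

Lemma gauss_support_gt0 t : f t = 1 -> 0 < dotv t (gauss t).
Proof.
move=> ft; rewrite /gauss dotvZr mulr_gt0 ?invr_gt0 ?enorm_grad_gt0//.
exact: dotv_grad_gt0.
Qed.

(** Take [t] maximising [u . t] over the compact sublevel set. It lies on the level set, since
    otherwise a small move along [u] would improve it; first-order optimality then makes the
    gradient a positive multiple of [u]. *)
Lemma gauss_surj u : enorm u = 1 -> exists2 t, f t = 1 & gauss t = u.
Proof.
move=> u1; have uu : dotv u u = 1 by rewrite -enorm_sqr u1 expr1n.
have [t] : exists2 t, t \in [set t | f t <= 1] &
    forall s, s \in [set t | f t <= 1] -> dotv u s <= dotv u t.
  apply: EVT_max_rV; first by exists 0; rewrite /= ltW.
    exact: sublevel_compact.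
  by apply: continuous_subspaceT; exact: dotv_continuous.
rewrite inE /= => ft1 tmax.
have {}tmax s : f s <= 1 -> dotv u s <= dotv u t.
  by move=> fs; apply: tmax; rewrite inE.
have ft : f t = 1.
  apply/eqP; rewrite eq_le ft1/= leNgt; apply/negP => flt.
  have [C [r [r0 _ up]]] := deriveP t u.
  set a := 'D_u f t in up.
  have aC : 0 < `|a| + `|C| + 1 by rewrite ltr_wpDl// addr_ge0.
  pose e := Num.min (Num.min r 1) ((1 - f t) / (`|a| + `|C| + 1)).
  have e0 : 0 < e by rewrite !lt_min r0 ltr01 divr_gt0// subr_gt0.
  have er : e <= r by rewrite !ge_min lexx.
  have e1 : e <= 1 by rewrite !ge_min lexx orbT.
  have eaC : e * (`|a| + `|C| + 1) <= 1 - f t.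
    by rewrite -ler_pdivlMr// ge_min lexx orbT.
  have : f (t + e *: u) <= 1.
    have er' : `|e| <= r by rewrite gtr0_norm.
    apply: (le_trans (up e er')).
    have : a * e <= `|a| * e by rewrite ler_wpM2r ?ler_norm// ltW.
    have : C * e ^+ 2 <= `|C| * e.
      apply: (@le_trans _ _ (`|C| * e ^+ 2)); first by rewrite ler_wpM2r ?sqr_ge0 ?ler_norm.
      by rewrite ler_wpM2l// expr2 ler_piMl// ltW.
    lra.
  by move=> /tmax; rewrite dotvDr dotvZr uu; lra.
(* If b = u.g were smaller than n = |g|, moving from t along the component of u
   orthogonal to g, tilted slightly against g, would stay in the sublevel set
   and increase u.t. Hence b >= n, the equality case of Cauchy-Schwarz. *)
have desc h : dotv (grad f t) h < 0 -> dotv u h <= 0.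
  move=> gh; have [C [r [r0 _ up]]] := deriveP t h.
  rewrite derive_grad ft in up; set a := dotv _ _ in gh up.
  have C1 : 0 < `|C| + 1 by rewrite ltr_wpDl.
  pose e := Num.min r (- a / (`|C| + 1)).
  have e0 : 0 < e by rewrite lt_min r0 divr_gt0// oppr_gt0.
  have eC : e * (`|C| + 1) <= - a by rewrite -ler_pdivlMr// ge_min lexx orbT.
  have : f (t + e *: h) <= 1.
    have er' : `|e| <= r by rewrite gtr0_norm// ge_min lexx.
    apply: (le_trans (up e er')); rewrite -addrA gerDl expr2 mulrA -mulrDl.
    rewrite pmulr_lle0//; have : C * e <= `|C| * e by rewrite ler_wpM2r ?ler_norm// ltW.
    lra.
  by move=> /tmax; rewrite dotvDr dotvZr gerDl pmulr_rle0.
exists t => //; rewrite /gauss.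
have n0 := enorm_grad_gt0 ft; set g := grad f t in desc n0 *.
have gg := enorm_sqr g; set n := enorm g in n0 gg *.
pose b := dotv u g.
have b0 : 0 <= b.
  have := desc (- g); rewrite -scaleN1r !dotvZr -gg mulN1r oppr_lt0 exprn_gt0//.
  by rewrite mulN1r oppr_le0; apply.
have bn : n ^+ 2 <= b ^+ 2.
  rewrite leNgt; apply/negP => bn.
  have n2 : 0 < n ^+ 2 by rewrite exprn_gt0.
  pose D := 1 - b ^+ 2 / n ^+ 2.
  have D0 : 0 < D by rewrite subr_gt0 ltr_pdivrMr// mul1r.
  have b1 : 0 < 2 * (b + 1) by lra.
  (* The tilt is small enough that [eta * b < D]: the direction below descends for [f], yet its
     product with [u] is [D - eta * b > 0]. *)
  pose eta := D / (2 * (b + 1)).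
  have eta0 : 0 < eta by rewrite divr_gt0.
  have etaE : eta * (2 * (b + 1)) = D by rewrite /eta divfK// gt_eqF.
  have := desc (u + (- (b / n ^+ 2) - eta) *: g).
  rewrite !dotvDr !dotvZr -gg (dotvC g u) uu -/b.
  have -> : b + (- (b / n ^+ 2) - eta) * n ^+ 2 = - (eta * n ^+ 2).
    by field; rewrite gt_eqF.
  rewrite oppr_lt0 mulr_gt0// => /(_ isT).
  have -> : 1 + (- (b / n ^+ 2) - eta) * b = D - eta * b.
    by rewrite /D; field; rewrite gt_eqF.
  nra.
have nb : n <= b by rewrite -(ler_pXn2r (n := 2)) ?nnegrE// ltW.
(* The squared length of [g / n - u] is [2 (1 - b / n)], which is at most 0. *)
apply/eqP; rewrite -subr_eq0; apply/eqP/dotvv_eq0/le_anti.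
rewrite dotvv_ge0 andbT -(scaleN1r u) !(dotvDl, dotvDr, dotvZl, dotvZr) uu -gg (dotvC g u) -/b.
rewrite [leLHS](_ : _ = 2 * (1 - b / n)); last by field; rewrite gt_eqF.
by rewrite pmulr_rle0// subr_le0 ler_pdivlMr// mul1r.
Qed.

(** * The polar of the sublevel set *)

Definition polar : set 'rV[R]_d := [set v | forall s, f s <= 1 -> dotv s v <= 1].

Lemma polar_convex : convex_set polar.
Proof.
move=> x y k; rewrite !inE => Kx Ky s fs.
rewrite dotvDr !dotvZr -[unstable.onem _]/(1 - k%:num).
have k0 : 0 <= k%:num by [].
have k1 : k%:num <= 1 by [].
have k1' : 0 <= 1 - k%:num by rewrite subr_ge0.
have := ler_wpM2l k0 (Kx s fs); have := ler_wpM2l k1' (Ky s fs).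
lra.
Qed.

Lemma polar_closed : closed polar.
Proof.
have -> : polar = \bigcap_(s in [set s | f s <= 1]) [set v | dotv s v <= 1].
  by apply/seteqP; split=> v.
by apply: closed_bigI => s _; exact: closed_dotv_le.
Qed.

(** A uniform gap [1 - r] survives a small change of [v], because the sublevel set is bounded. [B]
    bounds the sum of the moduli of the coordinates of [s], the norm dual to the sup norm of the
    ball. *)
Lemma polar_interior v r : r < 1 -> (forall s, f s <= 1 -> dotv s v <= r) ->
  interior polar v.
Proof.
move=> r1 hv; have [M MP] := choice f_bounded.
pose B := \sum_k `|M k| + 1.
have B0 : 0 < B by rewrite ltr_wpDl// sumr_ge0.
rewrite /interior/=; apply/nbhs_ballP; exists ((1 - r) / B).
  by rewrite /= divr_gt0// subr_gt0.
move=> w; rewrite -ball_normE /= ltr_pdivlMr// => vw s fs.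
have : dotv s (w - v) <= `|v - w| * B.
  apply: (le_trans (ler_norm _)); apply: (le_trans (ler_norm_sum _ _ _)).
  rewrite mulrDr mulr1 -[leLHS]addr0; apply: lerD => //.
  rewrite mulr_sumr; apply: ler_sum => k _; rewrite normrM mulrC; apply: ler_pM => //.
    by rewrite distrC; exact: coord_le_norm.
  by apply: (le_trans (MP k s fs)); exact: ler_norm.
have -> : dotv s w = dotv s v + dotv s (w - v) by rewrite -dotvDr subrKC.
by have := hv s fs; lra.
Qed.

(** By [gauss_support], [ginv u . u] is the support function of the sublevel set at [u], whatever
    right inverse [ginv] is chosen. The boundary of the polar is where this function, extended by
    homogeneity, equals 1. *)
Lemma polar_boundary (ginv : 'rV[R]_d -> 'rV[R]_d) :
  (forall u, enorm u = 1 -> f (ginv u) = 1 /\ gauss (ginv u) = u) ->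
  [set (dotv (ginv u) u)^-1 *: u | u in @usphere R d] = boundary polar.
Proof.
move=> ginvP.
have hu u : enorm u = 1 -> 0 < dotv (ginv u) u.
  by move=> /ginvP[f1 gu]; rewrite -{2}gu gauss_support_gt0.
have su u s : enorm u = 1 -> f s <= 1 -> dotv s u <= dotv (ginv u) u.
  by move=> /ginvP[f1 gu] fs; have := gauss_support f1 fs; rewrite gu.
rewrite /boundary -(closure_id polar).1; last exact: polar_closed.
apply/seteqP; split=> v.
  move=> [u u1 <-]; have h0 := hu u u1; split.
    by move=> s fs; rewrite dotvZr ler_pdivrMl// mulr1 su.
  (* [w] is not interior: stretching it by [1 + e] violates the constraint of the point [ginv u]. *)
  set w := _ *: u; have tw : dotv (ginv u) w = 1 by rewrite dotvZr mulVf// gt_eqF.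
  clearbody w.
  move=> /nbhs_ballP[r /= r0 rK].
  have w1 : 0 < `|w| + 1 by rewrite ltr_wpDl.
  pose e := r / (`|w| + 1).
  have e0 : 0 < e by rewrite divr_gt0.
  have : polar (w + e *: w).
    apply: rK; rewrite -ball_normE /= opprD addrA subrr add0r normrN normrZ gtr0_norm//.
    by rewrite /e mulrAC ltr_pdivrMr// ltr_pM2l// ltrDl.
  have f1 := (ginvP u u1).1.
  move=> /(_ (ginv u)); rewrite f1 lexx => /(_ isT).
  by rewrite dotvDr dotvZr tw; lra.
move=> [Kv nKv].
have vn0 : v != 0.
  apply/eqP => v0; apply: nKv; apply: (@polar_interior _ 0) => // s _.
  by rewrite v0 dotvC dotv0l.
have nv0 : 0 < enorm v.
  rewrite lt_neqAle sqrtr_ge0 andbT; apply/eqP => n0.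
  by move/eqP: vn0; apply; apply: dotvv_eq0; rewrite -enorm_sqr -n0 expr0n.
pose u := (enorm v)^-1 *: v.
have u1 : enorm u = 1.
  rewrite /enorm dotvZl dotvZr -enorm_sqr expr2 mulKf ?gt_eqF// mulVf ?gt_eqF//.
  by rewrite sqrtr1.
have vE : v = enorm v *: u by rewrite scalerA mulfV ?gt_eqF// scale1r.
have dE s : dotv s v = enorm v * dotv s u by rewrite [in LHS]vE dotvZr.
have le1 : dotv (ginv u) v <= 1 by apply: Kv; rewrite (ginvP u u1).1.
(* Were the support value at [v] below 1, [v] would be interior to the polar. *)
have eq1 : dotv (ginv u) v = 1.
  apply/eqP; rewrite eq_le le1/= leNgt; apply/negP => lt1.
  apply: nKv; apply: (polar_interior lt1) => s fs.
  by rewrite !dE ler_pM2l// su.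
exists u => //; rewrite [RHS]vE; congr (_ *: _).
have h0 := hu u u1; apply: (mulIf (lt0r_neq0 h0)).
by rewrite mulVf ?gt_eqF// -dE eq1.
Qed.

End ConvexGradient.

Theorem proposition33 (R : realType) (d p : nat)
  (hd : (1 <= d)%N) (hp : (1 <= p)%N)
  (c : 'rV[int]_d -> 'I_p -> 'I_p -> R) (m : 'I_p -> R)
  (c_ge0 : forall x i j, 0 <= c x i j)
  (sigma_pos_fin : forall i, (0 < sigma c i < +oo)%E)
  (m_ge1 : forall i, 1 <= m i)
  (hA : assumptionA c m) :
  exists K : set 'rV[R]_d, convex_set K /\ limit_curve c m = boundary K.
Proof.
(* The Perron lemmas are stated for a nonempty index set, hence the size [p.+1]. *)
case: p hp c m c_ge0 sigma_pos_fin m_ge1 hA => [//|p] _ c m c_ge0 sigma_fin m_ge1 hA.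
have rho_cvx := rho_convex c_ge0 sigma_fin m_ge1 hA.
have rho_pert := rho_perturb c_ge0 sigma_fin m_ge1 hA.
have rho0 := rho0_lt1 c_ge0 sigma_fin m_ge1 hA.
have rho_bnd := rho_le1_bounded c_ge0 sigma_fin m_ge1 hA.
exists (polar (rho c m)); split; first exact: polar_convex.
(* For a surjection [pinv] is a right inverse with values in [dT], which is what [polar_boundary]
   asks of [Gam_inv]. *)
have surj : set_surj (dT c m) (@usphere R d) (Gam c m).
  move=> u u1.
  by have [t t1 <-] := gauss_surj rho_cvx rho_pert rho0 rho_bnd u1; exists t.
apply: (polar_boundary rho_cvx rho_pert rho0 rho_bnd) => u u1; split.
  by apply: (surjpinv_image_sub surj); exists u.
exact: (surjpK _ surj) (mem_set u1).
Qed.
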